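(* Let $G$ be a finite group, let $*$ be a nonidentical involutory antiautomorphism of $G$ with $gg^*\in Z(G)$ for every $g\in G$, and let $g_0\in Z(G)$ with $g_0^*=g_0$. Let $\beta\in\{xy,\,x^*y,\,yx,\,yx^*\}$, $\gamma\in\{xy,\,yx\}$ and $\delta\in\{g_0xy,\,g_0xy^*,\,g_0x^*y,\,g_0x^*y^*,\,g_0yx,\,g_0yx^*,\,g_0y^*x,\,g_0y^*x^*\}$. Then the loop $L=Q(G,*,g_0,\beta,\gamma,\delta)$ is right Bol if and only if at least one of the following holds: (a) $L$ is Moufang; (b) $G/Z(G)$ is an elementary abelian $2$-group and $(\beta,\gamma,\delta)$ is among $(yx,xy,g_0yx)$, $(yx^*,yx,g_0x^*y)$; (c) $G$ is commutative, $(xx)^*=xx$ for every $x\in G$, and $(\beta,\gamma,\delta)$ is among $(xy,xy,g_0xy^* )$, $(x^*y,xy,g_0x^*y^* )$; (d) $G/Z(G)$ is an elementary abelian $2$-group, $(xx)^*=xx$ for every $x\in G$, and $(\beta,\gamma,\delta)$ is among $(xy,xy,g_0xy^* )$, $(x^*y,yx,g_0y^*x^* )$, $(yx,xy,g_0y^*x)$, $(yx^*,yx,g_0x^*y^* )$.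
   Context: $Z(G)$ is the center of $G$. An involutory antiautomorphism $*$ of $G$ satisfies $(g^* )^*=g$ and $(gh)^*=h^*g^*$; nonidentical means $g^*\neq g$ for some $g\in G$. A word such as $yx^*$ or $g_0y^*x$ denotes the function $G\times G\to G$ sending $(x,y)$ to the value of the word. Words are regarded as functions: two words are identified when they define the same function on $G\times G$ (for instance $xy$ and $yx$ when $G$ is commutative), and equality of triples $(\beta,\gamma,\delta)$ means equality of the three functions. Let $Gu=\{gu : g\in G\}$ be a disjoint copy of $G$. The loop $Q(G,*,g_0,\beta,\gamma,\delta)$ is the set $G\cup Gu$ with the multiplication, for $x,y\in G$, $$x\circ y=xy,\quad x\circ yu=\beta(x,y)u,\quad xu\circ y=\gamma(x,y)u,\quad xu\circ yu=\delta(x,y).$$ It is a loop with neutral element $1\in G$. The trivial group counts as an elementary abelian $2$-group. A loop is right Bol if it satisfies $x((yz)y)=((xy)z)y$, and Moufang if it satisfies $x(y(xz))=((xy)x)z$. *)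

(* Defs.v *)
From mathcomp Require Import all_boot all_fingroup all_solvable.

Set Implicit Arguments.
Unset Strict Implicit.
Unset Printing Implicit Defensive.

Section LoopIdentities.

Variables (T : Type) (op : T -> T -> T) (e : T).

Definition is_loop : Prop :=
  [/\ left_id e op, right_id e op,
      forall a b, exists! x, op a x = b
    & forall a b, exists! y, op y a = b].

Definition right_bol_loop : Prop :=
  is_loop /\
  forall x y z, op x (op (op y z) y) = op (op (op x y) z) y.

Definition moufang_loop : Prop :=
  is_loop /\
  forall x y z, op x (op y (op x z)) = op (op (op x y) x) z.

End LoopIdentities.

Section Construction.

Variable gT : finGroupType.

(* Words are finite functions, so that [=] and [\in] on words, and on triples
   of words, compare values on [gT * gT] and not the spelling of the words. *)
Definition wordfun := {ffun gT * gT -> gT}.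

Definition word (f : gT -> gT -> gT) : wordfun := [ffun p => f p.1 p.2].

(* [inl x] is the element x of G and [inr x] is the element xu of Gu.  The
   antiautomorphism and g0 enter only through the three words. *)
Definition Qmul (beta gamma delta : wordfun) (a b : gT + gT) : gT + gT :=
  match a, b with
  | inl x, inl y => inl (x * y)%g
  | inl x, inr y => inr (beta (x, y))
  | inr x, inl y => inr (gamma (x, y))
  | inr x, inr y => inl (delta (x, y))
  end.

Definition Qone : gT + gT := inl 1%g.

End Construction.

(* Main.v *)
(* Write the right Bol identity out according to which of x, y, z lie in Gu; as
   every word is homogeneous in the central element g0, g0 cancels.  Evaluating
   the resulting word identities at 1 shows that x is starred in delta iff it is
   in beta, and that gamma and the order of the factors in delta are determined
   by beta, unless G is commutative, when the order of factors does not change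
   the word.  This leaves eight triples: the four words beta, with y starred or
   not in delta.  Since y star(y) is central, the remaining identities reduce to
   star(y) z y = y z star(y), i.e. all squares are central, or to
   star(y) z star(y) = y z y, i.e. moreover squares are fixed by star.  For two
   triples they hold unconditionally; these two loops are flexible, and a
   flexible right Bol loop is Moufang. *)
Require Import Defs.
From mathcomp Require Import all_boot all_fingroup all_solvable.

Set Implicit Arguments.
Unset Strict Implicit.
Unset Printing Implicit Defensive.

Local Open Scope group_scope.

(** * Loops with the inverse property *)

Section InverseProperty.

Variables (T : Type) (op : T -> T -> T) (e : T).
Hypothesis op1r : right_id e op.

Definition inverse_pair (a a' : T) : Prop :=
  [/\ forall z, op a' (op a z) = z, forall z, op a (op a' z) = z,
      forall z, op (op z a) a' = z & forall z, op (op z a') a = z].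

Definition inverse_property : Prop := forall a, exists a', inverse_pair a a'.

(** Here ca = e, so a = b(ca) = b. An equation thus follows once both sides are given the same
    inverse. *)
Lemma inverse_pair_inj a b c : inverse_pair a c -> inverse_pair b c -> a = b.
Proof.
case=> ca _ _ _ [_ bc _ _].
by rewrite -[a]bc -[X in op c X]op1r ca op1r.
Qed.

Hypothesis IP : inverse_property.

(** If c inverts ab, then b' = c((ab)b') = ca, hence b'a' = (ca)a' = c. *)
Lemma inverse_pairM a b a' b' :
  inverse_pair a a' -> inverse_pair b b' -> inverse_pair (op a b) (op b' a').
Proof.
move=> [_ _ aK _] [_ _ bK _]; have [c abc] := IP (op a b).
suffices -> : op b' a' = c by [].
case: abc => cK _ _ _.
by rewrite -(cK b') bK aK.
Qed.

(* Inversion is an antiautomorphism, so it carries the identity to its mirror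
   image. *)
Lemma moufang_bol_mirror :
  (forall x y, op x (op y x) = op (op x y) x) ->
  (forall x y z, op x (op y (op x z)) = op (op (op x y) x) z) <->
  (forall x y z, op x (op (op y z) y) = op (op (op x y) z) y).
Proof.
move=> flex; split=> [H|H] x y z; have [x' xx'] := IP x;
  have [y' yy'] := IP y; have [z' zz'] := IP z.
  (* Flexibility and the Moufang identity rewrite this element as (y'(z'y'))x' and as y'(z'(y'x')),
     the inverses of the two sides. *)
  apply: (@inverse_pair_inj _ _ (op (op (op y' z') y') x')).
    by rewrite -[op (op y' z') y']flex; do !apply: inverse_pairM.
  by rewrite -H; do !apply: inverse_pairM.
apply: (@inverse_pair_inj _ _ (op (op (op z' x') y') x')).
  by do !apply: inverse_pairM.
by rewrite -H -flex; do !apply: inverse_pairM.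
Qed.

End InverseProperty.

(** * Moufang loops and flexible right Bol loops *)

Section FlexibleLoops.

Variables (T : Type) (op : T -> T -> T) (e : T).

(** The Moufang identity gives flexibility at z = e and the left inverse property at y = x'; the
    right one follows on writing z as xw. *)
Lemma moufang_right_bol : moufang_loop op e -> right_bol_loop op e.
Proof.
move=> [loop H]; have [op1l op1r lcan rcan] := loop.
have flex x y : op x (op y x) = op (op x y) x.
  by have := H x y e; rewrite !op1r.
have linj x : injective (op x).
  by move=> u v eq_uv; have [w [_ uw]] := lcan x (op x u);
    rewrite -(uw u (erefl _)); apply: uw.
have IP : inverse_property op.
  move=> x; have [x' [xx' _]] := lcan x e.
  have lK z : op x' (op x z) = z by apply: (linj x); rewrite H xx' op1l.
  have x'x : op x' x = e by rewrite -[RHS](lK e) op1r.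
  have rK z : op (op z x) x' = z.
    have [w [<- _]] := lcan x z.
    by rewrite -H xx' op1r.
  exists x'; split=> // z; first by apply: (linj x'); rewrite lK.
  by have [w [<- _]] := rcan x z; rewrite rK.
by split=> //; apply/(moufang_bol_mirror op1r IP flex).
Qed.

(** The right inverse property comes from the Bol identity at z = y'; flexibility then carries it
    over to the left. *)
Lemma flexible_right_bol_moufang :
  (forall x y, op x (op y x) = op (op x y) x) ->
  right_bol_loop op e -> moufang_loop op e.
Proof.
move=> flex [loop H]; have [op1l op1r lcan rcan] := loop.
have rinj x : injective (op^~ x).
  by move=> u v eq_uv; have [w [_ uw]] := rcan x (op u x);
    rewrite -(uw u (erefl _)); apply: uw.
have IP : inverse_property op.
  move=> x; have [x' [xx' _]] := lcan x e.
  have rK z : op (op z x) x' = z.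
    by apply: (rinj x); rewrite /= -H xx' op1l.
  have x'x : op x' x = e.
    by apply: (rinj x'); rewrite rK op1l.
  have lK z : op x' (op x z) = z.
    have [w [<- _]] := rcan x z.
    by rewrite flex H x'x op1l.
  exists x'; split=> // z; last by apply: (rinj x'); rewrite rK.
  by have [w [<- _]] := lcan x z; rewrite lK.
by split=> //; apply/(moufang_bol_mirror op1r IP flex).
Qed.

End FlexibleLoops.

(** * Words twisted by the antiautomorphism *)

Section Twists.

Variables (gT : finGroupType) (star : gT -> gT).

Definition twist (swap sx sy : bool) (x y : gT) : gT :=
  let a := if sx then star x else x in
  let b := if sy then star y else y in
  if swap then b * a else a * b.

(** Bracketed like the words for delta in the theorem, which are then instances by conversion. *)
Definition scaled_twist (g0 : gT) (swap sx sy : bool) (x y : gT) : gT :=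
  let a := if sx then star x else x in
  let b := if sy then star y else y in
  if swap then g0 * b * a else g0 * a * b.

Lemma scaled_twistE g0 s t u x y :
  scaled_twist g0 s t u x y = g0 * twist s t u x y.
Proof. by rewrite /scaled_twist /twist; case: s; rewrite mulgA. Qed.

Definition twisted_mul (g0 : gT) (bswap bstar cswap dswap dsx dsy : bool) :=
  Qmul (word (twist bswap bstar false)) (word (twist cswap false false))
       (word (scaled_twist g0 dswap dsx dsy)).

(* Each field is named after the variables of x((yz)y) = ((xy)z)y that lie in
   Gu; with none of them, or x alone, the identity is associativity in G. *)
Record bol_words (b c d : gT -> gT -> gT) : Prop := BolWords {
  bol_z : forall x y z, b x (c (b y z) y) = c (b (x * y) z) y;
  bol_y : forall x y z, x * d (c y z) y = d (c (b x y) z) y;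
  bol_yz : forall x y z, b x (b (d y z) y) = b (d (b x y) z) y;
  bol_xz : forall x y z, d x (c (b y z) y) = d (c x y) z * y;
  bol_xy : forall x y z, c x (d (c y z) y) = b (d x y * z) y;
  bol_xyz : forall x y z, d x (b (d y z) y) = d (b (d x y) z) y }.

Hypothesis starK : involutive star.
Hypothesis starM : forall x y, star (x * y) = star y * star x.
Hypothesis norm_central : forall x, x * star x \in 'Z([set: gT]).

Lemma centralC z : z \in 'Z([set: gT]) -> forall x, z * x = x * z.
Proof. by move=> /centerP[_ zC] x; apply: zC; rewrite inE. Qed.

Lemma star1 : star 1 = 1.
Proof. by apply: (mulgI (star 1)); rewrite -starM !mulg1. Qed.

Lemma starC x : star x * x = x * star x.
Proof. by apply: (mulgI x); rewrite mulgA; apply: centralC. Qed.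

Lemma normC x y : x * star x * y = y * x * star x.
Proof. by rewrite centralC // mulgA. Qed.

Lemma twist1x s t y : twist s t false 1 y = y.
Proof. by case: s; case: t; rewrite /twist /= ?star1 ?mulg1 ?mul1g. Qed.

Lemma twistx1 s x : twist s false false x 1 = x.
Proof. by case: s; rewrite /twist /= ?mulg1 ?mul1g. Qed.

Lemma twist_injl s t u y : injective (twist s t u ^~ y).
Proof.
have inj : injective star := can_inj starK.
move=> x x'; rewrite /twist; by case: s; case: t;
  [move/mulgI/inj|move/mulgI|move/mulIg/inj|move/mulIg].
Qed.

Lemma twist_injr s t u x : injective (twist s t u x).
Proof.
have inj : injective star := can_inj starK.
move=> y y'; rewrite /twist; by case: s; case: u;
  [move/mulIg/inj|move/mulIg|move/mulgI/inj|move/mulgI].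
Qed.

(** * The central factor and the reduction to word identities *)

Section Scaling.

Variable g0 : gT.
Hypotheses (g0Z : g0 \in 'Z([set: gT])) (g0s : star g0 = g0).

Lemma twistZl s t u x y : twist s t u (g0 * x) y = g0 * twist s t u x y.
Proof.
have g0C := centralC g0Z.
by case: s; case: t; rewrite /twist /= ?starM ?g0s -?g0C !mulgA -?[_ * g0]g0C.
Qed.

Lemma twistZr s t u x y : twist s t u x (g0 * y) = g0 * twist s t u x y.
Proof.
have g0C := centralC g0Z.
by case: s; case: u; rewrite /twist /= ?starM ?g0s -?g0C !mulgA -?[_ * g0]g0C.
Qed.

(** The carrier is finite, so unique solvability reduces to injectivity of the translations. *)
Lemma twisted_mul_loop bs bt cs ds dx dy :
  is_loop (twisted_mul g0 bs bt cs ds dx dy) (Qone gT).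
Proof.
have bij_ex (f : gT + gT -> gT + gT) :
    injective f -> forall b, exists! x, f x = b.
  move=> /injF_bij[g fK gK] b; exists (g b); split=> [|x <-] //; exact: fK.
split=> [[x|x]|[x|x]|a b|a b];
  rewrite /= ?(ffunE, scaled_twistE) /= ?twist1x ?twistx1 ?mul1g ?mulg1 //.
  apply: bij_ex b; case: a => a [x|x] [y|y] //=;
    rewrite ?(ffunE, scaled_twistE) /= => -[].
  - by move/mulgI ->.
  - by move/twist_injr ->.
  - by move/twist_injr ->.
  - by move/mulgI/twist_injr ->.
apply: bij_ex b; case: a => a [x|x] [y|y] //=;
  rewrite ?(ffunE, scaled_twistE) /= => -[].
- by move/mulIg ->.
- by move/twist_injl ->.
- by move/twist_injl ->.
- by move/mulgI/twist_injl ->.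
Qed.

(** Both sides carry the same power of [g0]: none in [bol_z], two in [bol_xyz], one in the other
    identities. *)
Lemma twisted_bolP bs bt cs ds dx dy :
  right_bol_loop (twisted_mul g0 bs bt cs ds dx dy) (Qone gT) <->
  bol_words (twist bs bt false) (twist cs false false) (twist ds dx dy).
Proof.
have g0C := centralC g0Z.
split=> [[_ H]|[z_ y_ yz_ xz_ xy_ xyz_]].
  split=> x y z.
  - by have /= := H (inl x) (inl y) (inr z);
      rewrite !(ffunE, scaled_twistE) => -[].
  - have /= := H (inl x) (inr y) (inl z);
      rewrite !(ffunE, scaled_twistE) /= => -[].
    by rewrite mulgA -g0C -mulgA => /mulgI.
  - have /= := H (inl x) (inr y) (inr z);
      rewrite !(ffunE, scaled_twistE) /= => -[].
    by rewrite !(twistZl, twistZr) => /mulgI.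
  - have /= := H (inr x) (inl y) (inr z);
      rewrite !(ffunE, scaled_twistE) /= => -[].
    by rewrite -mulgA => /mulgI.
  - have /= := H (inr x) (inr y) (inl z);
      rewrite !(ffunE, scaled_twistE) /= => -[].
    by rewrite -mulgA !(twistZl, twistZr) => /mulgI.
  - have /= := H (inr x) (inr y) (inr z);
      rewrite !(ffunE, scaled_twistE) /= => -[].
    by rewrite !(twistZl, twistZr) => /mulgI/mulgI.
split; first exact: twisted_mul_loop.
move=> [x|x] [y|y] [z|z]; rewrite /= ?(ffunE, scaled_twistE) /=; congr (_ _).
- by rewrite !mulgA.
- exact: z_.
- by rewrite mulgA -g0C -mulgA y_.
- by rewrite !(twistZl, twistZr) yz_.
- by case: cs {z_ y_ xz_ xy_}; rewrite /twist /= !mulgA.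
- by rewrite -mulgA xz_.
- by rewrite -mulgA !(twistZl, twistZr) xy_.
- by rewrite !(twistZl, twistZr) xyz_.
Qed.

End Scaling.

(** * Conditions on squares *)

Definition squares_central := forall x : gT, x * x \in 'Z([set: gT]).

Definition squares_symmetric := forall x, star (x * x) = x * x.

Lemma squares_central_abelem :
  squares_central <-> 2.-abelem ([set: gT] / 'Z([set: gT])).
Proof.
have nZ x : x \in 'N('Z([set: gT])).
  by rewrite (subsetP (normal_norm (center_normal _))) ?inE.
split=> [sqZ | /abelemP[//|_ sq1] x].
  apply/exponent2_abelem/exponentP=> _ /morphimP[x _ _ ->].
  by rewrite -morphX //; apply: coset_id; rewrite expgS expg1.
apply: coset_idr; first exact: nZ.
by rewrite morphM //; apply: (sq1 (coset _ x)); rewrite mem_quotient ?inE.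
Qed.

(** Multiply by y on the left, move the central y star(y) past z and cancel star(y): what remains is
    z y y = y y z. *)
Lemma sandwich_swapP :
  squares_central <-> forall y z, star y * z * y = y * z * star y.
Proof.
split=> [sqZ y z | H y].
  by apply: (mulgI y); rewrite !mulgA normC (centralC (sqZ y)) -!mulgA starC.
apply/centerP; split=> [|z _]; first by rewrite inE.
apply: (mulIg (star y)); have /(congr1 (mulg y)) := H y z.
by rewrite !mulgA normC -!mulgA starC.
Qed.

(** The case z = 1 says that [star] fixes squares; given that, the rest reduces to z y y = y y z as
    before. *)
Lemma sandwich_starP :
  squares_central /\ squares_symmetric <->
  forall y z, star y * z * star y = y * z * y.
Proof.
split=> [[sqZ sqS] y z | H].
  apply: (mulgI y); rewrite !mulgA normC (centralC (sqZ y)) -!mulgA -starM.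
  by rewrite sqS.
have sqS : squares_symmetric by move=> y; have:= H y 1; rewrite !mulg1 starM.
split=> // y; apply/centerP; split=> [|z _]; first by rewrite inE.
apply: (mulIg y); have /(congr1 (mulg y)) := H y z.
by rewrite !mulgA normC -!mulgA -starM sqS.
Qed.

(** The two sides differ by moves of three kinds: shifting y star(y) ([nC], [sC]), shifting squares
    or exchanging y and star(y) around z ([E]), and dropping a pair of stars ([ET]). *)
Lemma canonical_bol_words bs bt dt :
  (bs || dt -> squares_central) -> (dt -> squares_symmetric) ->
  bol_words (twist bs bt false) (twist bt false false)
            (twist (bs (+) bt) bt dt).
Proof.
move=> sqZ sqS.
have nC y z w : w * y * star y * z = w * z * y * star y.
  by rewrite -!mulgA (mulgA y) normC !mulgA.
have sC y w : w * star y * y = w * y * star y by rewrite -!mulgA starC.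
have E y : bs || dt -> (forall z w, w * y * y * z = w * z * y * y)
    /\ forall z w, w * star y * z * y = w * y * z * star y.
  move/sqZ=> yZ; split=> z w.
    by rewrite -!mulgA (mulgA y) (centralC (yZ y)) !mulgA.
  by rewrite -!mulgA (mulgA (star y)) ((sandwich_swapP.1 yZ) y z) !mulgA.
have ET y : dt -> (forall w, w * star y * star y = w * y * y)
    /\ forall z w, w * star y * z * star y = w * y * z * y.
  move=> dtT; have yZ : squares_central by apply: sqZ; rewrite dtT orbT.
  split=> [w|z w]; first by rewrite -!mulgA -starM sqS // mulgA.
  have := (sandwich_starP.1 (conj yZ (sqS dtT))) y z.
  by rewrite -!mulgA => ->.
split=> x y z; move: (E y) (ET y); rewrite /twist; case: bs {sqZ E}; case: bt;
  case: dt {sqS ET} => /= E ET; rewrite ?starM ?starK ?mulgA //.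
(* nC, sC, E and ET rewrite behind a prefix w, so give every word one. *)
all: apply: (mulgI 1); rewrite !mulgA.
all: try by rewrite ?sC ?nC ?sC.
all: try (have {E} [sq sw] := E isT); try by rewrite ?sw ?sq ?sC ?nC ?sq.
all: try (have {ET} [sS ss] := ET isT); try by rewrite ?ss ?sS ?sq ?sC ?nC.
Qed.

(** * Conditions forced on the words *)

Definition commutative_group := forall x y : gT, x * y = y * x.

Lemma twist_commutative s s' t u x y :
  commutative_group -> twist s t u x y = twist s' t u x y.
Proof. by move=> gC; rewrite /twist; case: s; case: s' => //; rewrite gC. Qed.

(** At z = 1, with x and y starred as the star in beta requires, [bol_z] cancels to commutation when
    gamma has the other order. *)
Lemma bol_words_gamma bs bt cs d :
  bol_words (twist bs bt false) (twist cs false false) d ->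
  cs = bt \/ commutative_group.
Proof.
case=> zB _ _ _ _ _; have [->|neq] := eqVneq cs bt; [by left | right=> x y].
have := (zB x y 1, zB (star x) (star y) 1, zB (star x) y 1).
rewrite /twist; case: bs cs bt neq {zB} => -[] [] //= _ [[]];
  rewrite ?starM ?starK ?mulg1 ?mul1g -?mulgA.
- by move=> /mulgI ->.
- by move=> _ _ /mulgI ->.
- by rewrite !mulgA => /mulIg.
- by rewrite !mulgA => _ /mulIg.
Qed.

(** At y = z = 1, [bol_y] equates x with x starred once for each of [bt] and [dx] that is true. *)
Lemma bol_words_delta_star bs bt cs ds dx dy :
  (exists x, star x != x) ->
  bol_words (twist bs bt false) (twist cs false false) (twist ds dx dy) ->
  dx = bt.
Proof.
move=> [x /eqP nx] [_ yB _ _ _ _].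
have := yB x 1 1; rewrite /twist star1 !if_same.
by case: cs bs bt dx ds {yB} => -[] [] [] [];
  rewrite ?starM ?starK ?star1 ?mulg1 ?mul1g // => /esym.
Qed.

(** At z = 1 in [bol_y] the stars of beta and delta cancel on x; with the wrong order in delta, x is
    left commuting with y or star(y). *)
Lemma bol_words_delta_swap bs bt cs ds dy :
  cs = bt \/ commutative_group ->
  bol_words (twist bs bt false) (twist cs false false) (twist ds bt dy) ->
  ds = bs (+) bt \/ commutative_group.
Proof.
move=> [->|gC] [_ yB _ _ _ _]; last by right.
have [->|neq] := eqVneq ds (bs (+) bt); [by left | right=> x y].
have := (yB x y 1, yB x (star y) 1).
by rewrite /twist; case: bs bt ds neq dy {yB} => -[] [] //= _ [] [];
  rewrite ?starM ?starK ?star1 ?mulg1 ?mul1g ?mulgA => /mulIg + /mulIg.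
Qed.

(** One instance settles each of the six triples that carry a condition: x = 1 with star(z) for z,
    or z = 1 in [bol_z]. *)
Lemma canonical_bol_squares bs bt dt :
  bol_words (twist bs bt false) (twist bt false false)
            (twist (bs (+) bt) bt dt) ->
  (bs || dt -> squares_central) /\ (dt -> squares_symmetric).
Proof.
case=> zB _ _ xzB xyB _.
have reduce (P Q : Prop) : P /\ Q -> (bs || dt -> P) /\ (dt -> Q) by case.
have flip : (forall y z, star y * star y * z = z * y * y) ->
    squares_central /\ squares_symmetric.
  move=> H; have sqS : squares_symmetric.
    by move=> y; have := H y 1; rewrite mulg1 mul1g starM.
  split=> // y; apply/centerP; split=> [|z _]; first by rewrite inE.
  by rewrite /commute -{1}(sqS y) starM H mulgA.
case: bs bt dt zB xzB xyB reduce => -[] [] /=;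
  rewrite /twist /= => zB xzB xyB reduce.
- apply/reduce/sandwich_starP=> y z; have := xyB 1 y (star z).
  by rewrite ?starM ?starK ?star1 ?mul1g ?mulg1 ?mulgA.
- split=> // _; apply/sandwich_swapP=> y z; have := xyB 1 y (star z).
  by rewrite ?starM ?starK ?star1 ?mul1g ?mulg1 ?mulgA.
- apply/reduce/flip=> y z; have := xzB 1 y (star z).
  by rewrite ?starM ?starK ?mulg1 ?mul1g ?mulgA.
- split=> // _ y; apply/centerP; split=> [|z _]; first by rewrite inE.
  by have := zB z y 1; rewrite !mul1g /commute -?mulgA.
- apply/reduce/flip=> y z; have := xyB 1 y (star z).
  by rewrite ?starM ?starK ?star1 ?mul1g ?mulg1 ?mulgA.
- by split.
- apply/reduce/sandwich_starP=> y z; have := xzB 1 y (star z).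
  by rewrite ?starM ?starK ?mul1g ?mulgA.
- by split.
Qed.

Lemma word_twist_commutative s s' t u :
  commutative_group -> word (twist s t u) = word (twist s' t u).
Proof.
by move=> gC; apply/ffunP=> p; rewrite !ffunE (twist_commutative s s').
Qed.

Lemma word_scaled_twist_commutative g0 s s' t u :
  commutative_group ->
  word (scaled_twist g0 s t u) = word (scaled_twist g0 s' t u).
Proof.
move=> gC; apply/ffunP=> p.
by rewrite !ffunE !scaled_twistE (twist_commutative s s').
Qed.

(** * The eight canonical triples *)

Section Canonical.

Variable g0 : gT.
Hypotheses (g0Z : g0 \in 'Z([set: gT])) (g0s : star g0 = g0).

(* bs: the factors of beta are swapped; bt: its first factor is starred; dt:
   the second factor of delta is starred. *)
Definition canonical_mul (bs bt dt : bool) :=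
  twisted_mul g0 bs bt bt (bs (+) bt) bt dt.

Lemma canonical_bolP bs bt dt :
  right_bol_loop (canonical_mul bs bt dt) (Qone gT) <->
  (bs || dt -> squares_central) /\ (dt -> squares_symmetric).
Proof.
split=> [/(twisted_bolP g0Z g0s)/canonical_bol_squares // | [sqZ sqS]].
exact/(twisted_bolP g0Z g0s)/canonical_bol_words.
Qed.

Lemma canonical_moufang bt :
  moufang_loop (canonical_mul false bt false) (Qone gT).
Proof.
apply: flexible_right_bol_moufang; last exact/canonical_bolP.
have eqr (u v : gT) : u = v -> inr u = inr v :> gT + gT by move->.
have eql (u v : gT) : u = v -> inl (g0 * u) = inl (g0 * v) :> gT + gT by move->.
move=> [x|x] [y|y]; rewrite /= ?(ffunE, scaled_twistE); first by rewrite mulgA.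
- by apply: eqr; case: bt; rewrite /twist /= ?mulgA // starC.
- apply: eql; case: bt; rewrite /twist /= ?starM ?starK ?mulgA //.
  by rewrite -normC -starC.
- apply: eqr; rewrite (twistZl g0Z g0s) (twistZr g0Z g0s); congr (g0 * _).
  by case: bt; rewrite /twist /= ?starM ?starK ?mulgA.
Qed.

(** The conclusion compares functions and not flags, since over a commutative group the order of
    factors cannot be read off a word. *)
Lemma right_bol_canonical bs bt cs ds dx dy :
  (exists x, star x != x) ->
  right_bol_loop (twisted_mul g0 bs bt cs ds dx dy) (Qone gT) ->
  word (twist cs false false) = word (twist bt false false) /\
  word (scaled_twist g0 ds dx dy) = word (scaled_twist g0 (bs (+) bt) bt dy).
Proof.
move=> nonid /(twisted_bolP g0Z g0s) H.
have dxE := bol_words_delta_star nonid H; rewrite {dx}dxE in H *.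
have csE := bol_words_gamma H.
split; first by case: csE => [->|] //; apply: word_twist_commutative.
have [->|] := bol_words_delta_swap csE H; first by [].
exact: word_scaled_twist_commutative.
Qed.

End Canonical.

End Twists.

(** * The classification *)

Theorem theorem8p6 (gT : finGroupType) (star : gT -> gT)
    (star_invol : forall g, star (star g) = g)
    (star_anti : forall g h, star (g * h) = star h * star g)
    (star_nonid : exists g, star g != g)
    (star_central : forall g, g * star g \in 'Z([set: gT]))
    (g0 : gT) (g0_central : g0 \in 'Z([set: gT])) (g0_star : star g0 = g0)
    (beta gamma delta : wordfun gT)
    (beta_word : beta \in [:: word (fun x y => x * y);
                              word (fun x y => star x * y);
                              word (fun x y => y * x);
                              word (fun x y => y * star x)])
    (gamma_word : gamma \in [:: word (fun x y => x * y);
                                word (fun x y => y * x)])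
    (delta_word : delta \in [:: word (fun x y => g0 * x * y);
                                word (fun x y => g0 * x * star y);
                                word (fun x y => g0 * star x * y);
                                word (fun x y => g0 * star x * star y);
                                word (fun x y => g0 * y * x);
                                word (fun x y => g0 * y * star x);
                                word (fun x y => g0 * star y * x);
                                word (fun x y => g0 * star y * star x)]) :
  right_bol_loop (Qmul beta gamma delta) (Qone gT) <->
  [\/ moufang_loop (Qmul beta gamma delta) (Qone gT),
      2.-abelem ([set: gT] / 'Z([set: gT])) /\
      (beta, gamma, delta) \in
        [:: (word (fun x y => y * x), word (fun x y => x * y),
             word (fun x y => g0 * y * x));
            (word (fun x y => y * star x), word (fun x y => y * x),
             word (fun x y => g0 * star x * y))],
      [/\ abelian [set: gT],
          forall x, star (x * x) = x * x
        & (beta, gamma, delta) \in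
            [:: (word (fun x y => x * y), word (fun x y => x * y),
                 word (fun x y => g0 * x * star y));
                (word (fun x y => star x * y), word (fun x y => x * y),
                 word (fun x y => g0 * star x * star y))]]
    | [/\ 2.-abelem ([set: gT] / 'Z([set: gT])),
          forall x, star (x * x) = x * x
        & (beta, gamma, delta) \in
            [:: (word (fun x y => x * y), word (fun x y => x * y),
                 word (fun x y => g0 * x * star y));
                (word (fun x y => star x * y), word (fun x y => y * x),
                 word (fun x y => g0 * star y * star x));
                (word (fun x y => y * x), word (fun x y => x * y),
                 word (fun x y => g0 * star y * x));
                (word (fun x y => y * star x), word (fun x y => y * x),
                 word (fun x y => g0 * star x * star y))]]].

Proof.
have bolP :=
  canonical_bolP star_invol star_anti star_central g0_central g0_star.
have sqZP := squares_central_abelem gT.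
split.
  have [bs [bt ->]] : exists bs bt, beta = word (twist star bs bt false).
    by move: beta_word; rewrite !inE => /or4P[] /eqP ->;
      [exists false, false | exists false, true | exists true, false
      | exists true, true].
  have [cs ->] : exists cs, gamma = word (twist star cs false false).
    by move: gamma_word; rewrite !inE => /orP[] /eqP ->;
      [exists false | exists true].
  have [ds [dx [dy ->]]] :
      exists ds dx dy, delta = word (scaled_twist star g0 ds dx dy).
    move: delta_word; rewrite !inE.
    move=> /orP[|/orP[|/orP[|/orP[|/or4P[]]]]] /eqP ->.
    - by exists false, false, false.
    - by exists false, false, true.
    - by exists false, true, false.
    - by exists false, true, true.
    - by exists true, false, false.
    - by exists true, true, false.
    - by exists true, false, true.
    - by exists true, true, true.
  move=> H.
  have [gammaE deltaE] := right_bol_canonical star_invol star_anti g0_central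
    g0_star star_nonid H.
  move: H; rewrite gammaE deltaE => {gammaE deltaE}.
  (* A starred y in delta leads to (d), for commutative groups too, as their words are already in
     canonical order; otherwise [bs] decides between (b) and (a). *)
  case: dy => [/bolP[sqZ sqS]|].
    apply: Or44; split; [exact/sqZP/sqZ/orbT | exact: sqS |].
    by rewrite !inE; case: bs {sqZ}; case: bt;
      apply/or4P; [apply: Or44 | apply: Or43 | apply: Or42 | apply: Or41];
      apply/eqP.
  case: bs => [/bolP[sqZ _]|_].
    apply: Or42; split; first exact/sqZP/sqZ.
    by rewrite !inE; case: bt; apply/orP; [right | left]; apply/eqP.
  by apply: Or41; apply: canonical_moufang.
have bol_d bs bt : squares_central gT -> squares_symmetric star ->
    right_bol_loop (canonical_mul star g0 bs bt true) (Qone gT).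
  by move=> *; apply/bolP.
case.
- exact: moufang_right_bol.
- case=> /sqZP sqZ; rewrite !inE => /orP[] /eqP[-> -> ->].
    exact: (bolP true false false).2.
  exact: (bolP true true false).2.
- case=> /centsP gC sqS.
  have {}gC : commutative_group gT by move=> x y; apply: gC; rewrite inE.
  have sqZ : squares_central gT.
    by move=> x; apply/centerP; split=> [|y _]; rewrite ?inE //; apply: gC.
  rewrite !inE => /orP[] /eqP[-> -> ->]; first exact: (bol_d false false).
  (* The second triple of (c) is the second of (d) with the factors of gamma and delta exchanged. *)
  have := bol_d false true sqZ sqS.
  by rewrite /canonical_mul /twisted_mul (word_twist_commutative _ true false)
    ?(word_scaled_twist_commutative _ _ true false).
- case=> /sqZP sqZ sqS; rewrite !inE => /or4P[] /eqP[-> -> ->].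
  + exact: (bol_d false false).
  + exact: (bol_d false true).
  + exact: (bol_d true false).
  + exact: (bol_d true true).
Qed.
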